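(* Let $G$ be a finite subgroup of $\mathrm{PGL}_3(\mathbb{C})$. If $G$ is definable over $\mathbb{R}$, then its Jordan constant satisfies $J(G)\in\{1,2,3,6,60\}$.
   Context: A finite subgroup $G\subset\mathrm{PGL}_3(\mathbb{C})$ is definable over $\mathbb{R}$ if it is $\mathrm{PGL}_3(\mathbb{C})$-conjugate to some subgroup of $\mathrm{PGL}_3(\mathbb{R})$. The Jordan constant $J(\Gamma)$ of a group $\Gamma$ is the smallest positive integer such that any finite subgroup of $\Gamma$ has an abelian normal subgroup with index not exceeding $J(\Gamma)$. *)

(* Defs.v *)
From HB Require Import structures.
From mathcomp Require Import all_boot all_order all_algebra fingroup.
From mathcomp Require Import finmap generic_quotient.
From mathcomp Require Import boolp reals.
From mathcomp Require Import complex.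

Set Implicit Arguments.
Unset Strict Implicit.
Unset Printing Implicit Defensive.

Import GRing.Theory.
Local Open Scope ring_scope.
Local Open Scope quotient_scope.

Section GeneralLinear.
Variables (K : fieldType) (n : nat).

Record GL : Type := MkGL { GL_mx :> 'M[K]_n; GL_unit : GL_mx \in unitmx }.

HB.instance Definition _ := [isSub for GL_mx].
HB.instance Definition _ := [Choice of GL by <:].

Lemma GL_mul_unit (A B : GL) : A *m B \in unitmx.
Proof. by rewrite unitmx_mul !GL_unit. Qed.
Lemma GL_inv_unit (A : GL) : invmx A \in unitmx.
Proof. by rewrite unitmx_inv GL_unit. Qed.

Definition GL_mul (A B : GL) := MkGL (GL_mul_unit A B).
Definition GL_one := MkGL (unitmx1 K n).
Definition GL_inv (A : GL) := MkGL (GL_inv_unit A).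

Lemma GL_mulA : associative GL_mul.
Proof. by move=> A B C; apply/val_inj/mulmxA. Qed.
Lemma GL_mul1 : left_id GL_one GL_mul.
Proof. by move=> A; apply/val_inj/mul1mx. Qed.
Lemma GL_mulr1 : right_id GL_one GL_mul.
Proof. by move=> A; apply/val_inj/mulmx1. Qed.
Lemma GL_mulV : left_inverse GL_one GL_inv GL_mul.
Proof. by move=> A; apply/val_inj/mulVmx/GL_unit. Qed.
Lemma GL_mulrV : right_inverse GL_one GL_inv GL_mul.
Proof. by move=> A; apply/val_inj/mulmxV/GL_unit. Qed.

HB.instance Definition _ :=
  isGroup.Build GL GL_mulA GL_mul1 GL_mulr1 GL_mulV GL_mulrV.

Definition PGL_rel : rel GL := fun A B => is_scalar_mx (A * B^-1)%g.

Lemma PGL_relP (A B : GL) :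
  reflect (exists c : K, GL_mx A = c *: GL_mx B) (PGL_rel A B).
Proof.
apply: (iffP is_scalar_mxP) => /= -[c Ac]; exists c.
  by rewrite -mul_scalar_mx -Ac mulmxKV // GL_unit.
by rewrite Ac -scalemxAl mulmxV ?GL_unit // scalemx1.
Qed.

Lemma PGL_rel_equiv : equiv_class_of PGL_rel.
Proof.
have inv A B c : GL_mx A = c *: GL_mx B -> exists d, GL_mx B = d *: GL_mx A.
  have [-> A0|c0 ->] := eqVneq c 0; last first.
    by exists c^-1; rewrite scalerA mulVf ?scale1r.
  exists 1; rewrite scale1r A0 scale0r -[LHS](mulmxKV (GL_unit A)).
  by rewrite A0 scale0r mulmx0.
split=> [A|A B|B A C].
- by apply/PGL_relP; exists 1; rewrite scale1r.
- by apply/PGL_relP/PGL_relP => -[c /inv].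
- move=> /PGL_relP[c Ac] /PGL_relP[d Bd]; apply/PGL_relP; exists (c * d).
  by rewrite Ac Bd scalerA.
Qed.

Canonical PGL_equiv : equiv_rel GL := EquivRelPack PGL_rel_equiv.
Canonical PGL_equiv_direct := defaultEncModRel PGL_equiv.

Definition PGL := {eq_quot PGL_equiv}.

HB.instance Definition _ : EqQuotient _ PGL_equiv PGL :=
  EqQuotient.on PGL.
HB.instance Definition _ := Choice.on PGL.

Lemma PGL_piP (A B : GL) :
  \pi_PGL A = \pi_PGL B <-> exists c : K, GL_mx A = c *: GL_mx B.
Proof.
by split=> [/eqmodP/PGL_relP|e]; last by apply/eqmodP/PGL_relP.
Qed.

Definition PGL_one : PGL := \pi_PGL 1%g.
Definition PGL_mul (x y : PGL) : PGL := \pi_PGL (repr x * repr y)%g.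
Definition PGL_inv (x : PGL) : PGL := \pi_PGL (repr x)^-1%g.

Lemma PGL_piM (A B : GL) :
  \pi_PGL (A * B)%g = PGL_mul (\pi_PGL A) (\pi_PGL B).
Proof.
have /PGL_piP[c Ac] : \pi_PGL A = \pi_PGL (repr (\pi_PGL A)) by rewrite reprK.
have /PGL_piP[d Bd] : \pi_PGL B = \pi_PGL (repr (\pi_PGL B)) by rewrite reprK.
by apply/PGL_piP; exists (c * d); rewrite /= Ac Bd -scalemxAl -scalemxAr scalerA.
Qed.

Lemma PGL_mulA : associative PGL_mul.
Proof.
elim/quotW=> A; elim/quotW=> B; elim/quotW=> C.
by rewrite -(PGL_piM B C) -(PGL_piM A B) -(PGL_piM A) -(PGL_piM _ C) mulgA.
Qed.
Lemma PGL_mul1 : left_id PGL_one PGL_mul.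
Proof. by elim/quotW=> A; rewrite -(PGL_piM 1%g A) mul1g. Qed.
Lemma PGL_mulr1 : right_id PGL_one PGL_mul.
Proof. by elim/quotW=> A; rewrite -(PGL_piM A 1%g) mulg1. Qed.
Lemma PGL_mulV : left_inverse PGL_one PGL_inv PGL_mul.
Proof. by move=> x; rewrite -{2}[x]reprK -(PGL_piM (repr x)^-1%g) mulVg. Qed.
Lemma PGL_mulrV : right_inverse PGL_one PGL_inv PGL_mul.
Proof. by move=> x; rewrite -{1}[x]reprK -(PGL_piM _ (repr x)^-1%g) mulgV. Qed.

HB.instance Definition _ :=
  isGroup.Build PGL PGL_mulA PGL_mul1 PGL_mulr1 PGL_mulV PGL_mulrV.

End GeneralLinear.

Section BaseChange.
Variables (K L : fieldType) (f : {rmorphism K -> L}) (n : nat).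

Lemma GL_map_unit (A : GL K n) : map_mx f A \in unitmx.
Proof. by rewrite map_unitmx GL_unit. Qed.
Definition GL_map (A : GL K n) : GL L n := MkGL (GL_map_unit A).

Definition PGL_map (x : PGL K n) : PGL L n := \pi_(PGL L n) (GL_map (repr x)).

Lemma PGL_map_pi (A : GL K n) : PGL_map (\pi_(PGL K n) A) = \pi_(PGL L n) (GL_map A).
Proof.
have /PGL_piP[c rA] : \pi_(PGL K n) (repr (\pi_(PGL K n) A)) = \pi A
  by rewrite reprK.
by apply/PGL_piP; exists (f c); rewrite /= rA map_mxZ.
Qed.

Lemma PGL_mapM : {morph PGL_map : x y / (x * y)%g}.
Proof.
elim/quotW=> A; elim/quotW=> B.
rewrite -[(_ * _)%g](PGL_piM A B) !PGL_map_pi.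
rewrite -[RHS](PGL_piM (GL_map A)); congr (\pi_(PGL L n) _).
by apply/val_inj; rewrite /= map_mxM.
Qed.

End BaseChange.

Section FiniteSubgroups.
Variable gT : groupType.

Record finSubgroup : Type := FinSubgroup {
  fsg_fset :> {fset gT};
  fsg_closed : group_closed (mem fsg_fset)
}.

(* A finite subgroup regarded as a group in its own right. *)
Definition fsg_type (H : finSubgroup) : Type := fset_sub_type (fsg_fset H).

HB.instance Definition _ (H : finSubgroup) :=
  SubFinite.copy (fsg_type H) (fset_sub_type (fsg_fset H)).
HB.instance Definition _ (H : finSubgroup) :=
  SubChoice_isSubGroup.Build gT _ (fsg_type H) (fsg_closed H).

End FiniteSubgroups.

Section JordanConstant.
Variable gT : groupType.

Definition jordan_bound (n : nat) : Prop :=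
  forall H : finSubgroup gT, exists A : {group fsg_type H},
    [/\ (A <| [set: fsg_type H])%g, abelian A
      & #|[set: fsg_type H] : A|%g <= n]%N.

(* The value 0 stands for the absence of a bound. *)
Definition jordan_constant : nat :=
  if pselect (exists n, `[< (0 < n)%N /\ jordan_bound n >]) is left ex
  then ex_minn ex else 0%N.

Lemma jordan_constant_least (n : nat) :
  (0 < n)%N -> jordan_bound n ->
  [/\ (0 < jordan_constant)%N, jordan_bound jordan_constant
    & (jordan_constant <= n)%N].
Proof.
move=> n_gt0 bn; rewrite /jordan_constant; case: pselect => [ex|[]]; last first.
  by exists n; apply/asboolP.
case: ex_minnP => m /asboolP[m_gt0 bm] m_min; split=> //.
by apply/m_min/asboolP.
Qed.

End JordanConstant.

Definition definable_over_reals (R : realType) (G : finSubgroup (PGL R[i] 3)) :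
    Prop :=
  exists (H : {pred PGL R 3}) (g : PGL R[i] 3), group_closed H /\
    forall x : PGL R[i] 3,
      x \in fsg_fset G <->
      exists2 h, h \in H & (x ^ g)%g = PGL_map (real_complex R) h.

(* Main.v *)
Require Import Defs.
From mathcomp Require Import all_boot all_order all_algebra fingroup.
From mathcomp Require Import all_solvable zify ring lra.
From mathcomp Require Import finmap boolp reals complex.

(** A finite group conjugate into PGL_3(R) lifts isomorphically to SL_3(R),
    because every real number has exactly one real cube root: rescaling makes
    the determinant of a representative equal to 1, and does so in a single way
    ([definable_rotations]).  Averaging gives an invariant positive definite
    form, so the group consists of rotations of a Euclidean 3-space.  The same
    holds for each of its subgroups, and the Jordan constant of G is the
    largest, over the subgroups H of G, of the least index of an abelian normal
    subgroup of H ([jordan_constant_mem]).  Hence it is enough to show that this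
    least index lies in {1, 2, 3, 6, 60} for every finite rotation group H.

    Three facts about rotations are used: a nontrivial rotation fixes exactly one
    line pointwise, its axis; the rotations fixing a given nonzero vector
    commute; an isometry stabilising a line fixes it or reverses it.  So
    the pointwise stabilisers of the axes are abelian subgroups whose nontrivial
    elements partition H minus 1; conjugation permutes them, and each has index
    at most 2 in its normaliser ([rotation_axial]).

    The rest is group theory, without geometry.  Counting the nontrivial
    elements by conjugacy classes of axes gives, with N the order of H, b_i the
    order of a stabiliser in the i-th class and e_i the index of that
    stabiliser in its normaliser,

        N - 1 = sum over i of N (b_i - 1) / (e_i b_i).

    Each term is at least N/4, so there are at most three classes.  Either some
    stabiliser has index at most 2, and then the least index is 1 or 2, or N is
    12, 24 or 60 ([axial_orders]), as for the tetrahedral, octahedral and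
    icosahedral groups.  Order 12 yields a normal Sylow 2-subgroup of index 3,
    order 24 an abelian normal subgroup of order 4 and index 6, and in order 60
    a nontrivial abelian normal subgroup would contain more elements than an
    abelian group normalising an axis can have ([axial_min_abelian_index]). *)

Set Implicit Arguments.
Unset Strict Implicit.
Unset Printing Implicit Defensive.

(** * The diophantine class equation *)

Lemma muln_pred n b : 0 < b -> n * b.-1 + n = n * b.
Proof. by case: b => // b _; rewrite -mulnSr. Qed.

(** The case of two classes of axes, the first with stabilisers equal to their
    normalisers and the second with stabilisers of index 2: dividing by N, the
    equation reads 1/b1 + 1/(2 b2) = 1/2 + 1/N.  The bounds on b1 and b2
    exclude the dihedral solutions b1 = 2, N = 2 b2. *)
Lemma class_equation2 N n1 b1 n2 b2 :
  n1 * b1 = N -> n2 * 2 * b2 = N -> 1 < b1 -> 1 < b2 -> b1.*2 < N -> b2.*2 < N ->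
  n1 * b1.-1 + n2 * b2.-1 = N.-1 -> [/\ N = 12, b1 = 3 & b2 = 2].
Proof.
move=> N1 N2; case: b1 N1 => [|[|b1]] // N1 _; case: b2 N2 => [|[|b2]] // N2 _.
move=> /= c1 c2 sum.
have b2E : b2 = 0.
  case: (posnP b2) => // b2p; case: (posnP b1) => [b10|b1p]; first by subst; nia.
  have : n1 * 3 <= N by nia.
  have : n2 * 6 <= N by nia.
  nia.
(* The variables b1 and b2 now stand for the original ones minus 2. *)
subst b2; have : b1 < 2 by nia.
by case: b1 N1 c1 sum => [|[|]] // N1 c1 sum _; split; lia.
Qed.

(** With three classes all of index 2, the equation reads
    1/b1 + 1/b2 + 1/b3 = 1 + 2/N, so the sum of the reciprocals exceeds 1; the
    bound on b3 excludes the dihedral triples (2, 2, b). *)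
Lemma class_equation3_sorted N n1 b1 n2 b2 n3 b3 :
  n1 * 2 * b1 = N -> n2 * 2 * b2 = N -> n3 * 2 * b3 = N -> 1 < b1 ->
  b1 <= b2 -> b2 <= b3 -> b3.*2 < N ->
  n1 * b1.-1 + n2 * b2.-1 + n3 * b3.-1 = N.-1 ->
  [/\ b1 = 2, b2 = 3 & (b3, N) \in [:: (3, 12); (4, 24); (5, 60)]].
Proof.
move=> N1 N2 N3 b1_gt1 le12 le23 c3 sum.
have sumn : (n1 + n2 + n3) * 2 = N + 2.
  have e1 := muln_pred n1 (ltnW b1_gt1).
  have e2 : n2 * b2.-1 + n2 = n2 * b2 by apply: muln_pred; lia.
  have e3 : n3 * b3.-1 + n3 = n3 * b3 by apply: muln_pred; lia.
  lia.
(* Replacing b by a lower bound k turns each n * 2 * b = N into a linear bound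
   on n, which is then compared with sumn. *)
have le_classes n b k : n * 2 * b = N -> k <= b -> n * 2 * k <= N.
  by move=> <-; rewrite leq_mul2l orbC => ->.
have n3_gt1 : 1 < n3 by case: n3 N3 {sum sumn} => [|[|n]] // N3; lia.
have b1E : b1 = 2.
  suff : b1 < 3 by lia.
  rewrite ltnNge; apply/negP => b1_ge3.
  have := le_classes _ _ 3 N1 b1_ge3.
  have := le_classes _ _ 3 N2 (leq_trans b1_ge3 le12).
  have := le_classes _ _ 3 N3 (leq_trans b1_ge3 (leq_trans le12 le23)).
  lia.
subst b1.
have b2E : b2 = 3.
  have : b2 < 4.
    rewrite ltnNge; apply/negP => b2_ge.
    have := le_classes _ _ 4 N2 b2_ge.
    have := le_classes _ _ 4 N3 (leq_trans b2_ge le23).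
    lia.
  have : b2 <> 2 by move=> b22; subst b2; lia.
  lia.
subst b2.
have b3_lt6 : b3 < 6.
  rewrite ltnNge; apply/negP => b3_ge.
  have := le_classes _ _ 6 N3 b3_ge.
  lia.
split=> //; case: b3 le23 b3_lt6 c3 N3 {sum} => [|[|[|[|[|[|]]]]]] // _ _ _ N3.
- by have -> : N = 12 by lia.
- by have -> : N = 24 by lia.
- by have -> : N = 60 by lia.
Qed.

Lemma class_equation3 N n1 b1 n2 b2 n3 b3 :
  n1 * 2 * b1 = N -> n2 * 2 * b2 = N -> n3 * 2 * b3 = N ->
  1 < b1 -> 1 < b2 -> 1 < b3 -> b1.*2 < N -> b2.*2 < N -> b3.*2 < N ->
  n1 * b1.-1 + n2 * b2.-1 + n3 * b3.-1 = N.-1 ->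
  exists b, perm_eq [:: b1; b2; b3] [:: 2; 3; b] /\
            (b, N) \in [:: (3, 12); (4, 24); (5, 60)].
Proof.
have sorted m1 a1 m2 a2 m3 a3 : perm_eq [:: b1; b2; b3] [:: a1; a2; a3] ->
    m1 * 2 * a1 = N -> m2 * 2 * a2 = N -> m3 * 2 * a3 = N -> 1 < a1 ->
    a3.*2 < N -> m1 * a1.-1 + m2 * a2.-1 + m3 * a3.-1 = N.-1 ->
    a1 <= a2 -> a2 <= a3 -> exists b, perm_eq [:: b1; b2; b3] [:: 2; 3; b] /\
            (b, N) \in [:: (3, 12); (4, 24); (5, 60)].
  move=> perm_b N1 N2 N3 a1_gt1 a3_lt sum le12 le23.
  have [e1 e2 b3N] := class_equation3_sorted N1 N2 N3 a1_gt1 le12 le23 a3_lt sum.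
  by exists a3; move: perm_b; rewrite e1 e2.
move=> N1 N2 N3 g1 g2 g3 c1 c2 c3 sum.
case: (leqP b1 b2) => le12; case: (leqP b2 b3) => le23; case: (leqP b1 b3) => le13.
- by apply: (sorted n1 b1 n2 b2 n3 b3).
- by lia.
- apply: (sorted n1 b1 n3 b3 n2 b2); rewrite // ?(ltnW le23) //; last by lia.
  by rewrite perm_cons (perm_catC [:: b2] [:: b3]).
- apply: (sorted n3 b3 n1 b1 n2 b2); rewrite // ?(ltnW le13) //; last by lia.
  by rewrite (perm_catC [:: b1; b2] [:: b3]).
- apply: (sorted n2 b2 n1 b1 n3 b3); rewrite // ?(ltnW le12) //; last by lia.
  by rewrite (perm_catCA [:: b1] [:: b2] [:: b3]).
- apply: (sorted n2 b2 n3 b3 n1 b1); rewrite // ?(ltnW le13) //; last by lia.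
  by rewrite (perm_catC [:: b1] [:: b2; b3]).
- by lia.
- apply: (sorted n3 b3 n2 b2 n1 b1); rewrite // ?(ltnW le12) ?(ltnW le23) //; last by lia.
  by rewrite perm_sym (perm_rev [:: b1; b2; b3]).
Qed.

(** * Finite groups partitioned by the stabilisers of axes *)

Section AxialFamilies.
Local Open Scope group_scope.

(** The properties of the map sending a rotation g to the pointwise stabiliser
    A g of its axis that the group-theoretic part relies on: the sets (A g)^#
    partition G^#, conjugation permutes them, and A g has index at most 2 in its
    normaliser since an axis can only be fixed or reversed. *)
Record axial (gT : finGroupType) (G : {group gT}) (A : gT -> {group gT}) : Prop :=
  Axial {
    axial_sub : {in G^#, forall g, A g \subset G};
    axial_mem : {in G^#, forall g, g \in A g};
    axial_abelian : {in G^#, forall g, abelian (A g)};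
    axial_eq : {in G^#, forall g, {in (A g)^#, forall h, A h = A g}};
    axialJ : {in G^# & G, forall g x, A (g ^ x) = (A g :^ x)%G};
    axial_norm : {in G^#, forall g, #|'N_G(A g)| <= (#|A g|).*2}
  }.

Section AxialGroups.
Variables (gT : finGroupType) (G : {group gT}) (A : gT -> {group gT}).
Hypothesis axA : axial G A.

(** The nontrivial elements whose axis is conjugate to that of g. *)
Definition axis_class g := class_support (A g)^# G.

Lemma axial_subD1 g h : g \in G^# -> h \in (A g)^# -> h \in G^#.
Proof. by move=> Gg; apply/subsetP; rewrite setSD ?(axial_sub axA). Qed.

(** Two stabilisers that share a nontrivial element are equal, because that
    element determines its own axis. *)
Lemma axis_normedTI g : g \in G^# -> normedTI (A g)^# G 'N_G(A g).
Proof.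
move=> Gg; have [g_neq1 _] := setD1P Gg; apply/normedTI_P; split.
- by apply/set0Pn; exists g; rewrite !inE g_neq1 (axial_mem axA).
- by rewrite normD1.
move=> x Gx /pred0Pn[h /= /andP[Ah]]; case/imsetP=> k Ak hE; rewrite inE Gx /=.
have Gk := axial_subD1 Gg Ak.
apply/normP; have := axialJ axA Gk Gx; rewrite -hE (axial_eq axA Gg Ah).
by rewrite (axial_eq axA Gg Ak) => /(congr1 (@gval _)).
Qed.

Lemma card_axis_class g : g \in G^# ->
  #|axis_class g| = (#|G : 'N_G(A g)| * #|A g|.-1)%N.
Proof.
move=> Gg; rewrite (card_support_normedTI (axis_normedTI Gg)).
by rewrite (cardsD1 1 (A g)) group1 mulnC.
Qed.

Lemma axis_class_eq g h : g \in G^# -> h \in axis_class g ->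
  axis_class h = axis_class g.
Proof.
move=> Gg /imset2P[k x Ak Gx ->]; have Gk := axial_subD1 Gg Ak.
rewrite /axis_class (axialJ axA) // (axial_eq axA Gg Ak) /= -conjD1g.
by rewrite class_supportGidl.
Qed.

Lemma mem_axis_class g : g \in G^# -> g \in axis_class g.
Proof.
move=> Gg; apply: mem_class_support; have [g_neq1 _] := setD1P Gg.
by rewrite !inE g_neq1 (axial_mem axA).
Qed.

Lemma axis_class_partition : partition (axis_class @: G^#) G^#.
Proof.
have sub g : g \in G^# -> axis_class g \subset G^#.
  move=> Gg; apply/subsetP=> _ /imset2P[k x /(axial_subD1 Gg) Gk Gx ->].
  by rewrite memJ_norm // normD1 (subsetP (normG G)).
apply/and3P; split.
- rewrite eqEsubset; apply/andP; split.
    by apply/bigcupsP=> _ /imsetP[g Gg ->]; apply: sub.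
  apply/subsetP=> g Gg; apply/bigcupP; exists (axis_class g).
    exact: imset_f.
  exact: mem_axis_class.
- apply/trivIsetP=> _ _ /imsetP[g Gg ->] /imsetP[h Gh ->]; apply: contraNT.
  case/pred0Pn=> x /= /andP[gx hx].
  by rewrite -(axis_class_eq Gg gx) (axis_class_eq Gh hx).
- by apply/imsetP=> -[g Gg /setP/(_ g)]; rewrite inE mem_axis_class.
Qed.

Lemma axis_class_cards g h : g \in G^# -> h \in axis_class g ->
  #|A h| = #|A g| /\ #|'N_G(A h)| = #|'N_G(A g)|.
Proof.
move=> Gg /imset2P[k x Ak Gx ->]; have Gk := axial_subD1 Gg Ak.
rewrite (axialJ axA) // (axial_eq axA Gg Ak) /= cardJg; split=> //.
by rewrite normJ -{1}(conjGid Gx) -conjIg cardJg.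
Qed.

Lemma axial_gt1 g : g \in G^# -> 1 < #|A g|.
Proof.
move=> Gg; rewrite cardG_gt1; apply/trivgPn; exists g; first exact: (axial_mem axA).
by case/setD1P: Gg.
Qed.

Lemma axial_norm_cases g : g \in G^# ->
  #|'N_G(A g)| = #|A g| \/ #|'N_G(A g)| = (#|A g|).*2.
Proof.
move=> Gg; have sAN : A g \subset 'N_G(A g).
  by rewrite subsetI (axial_sub axA Gg) normG.
have /dvdnP[k kE] := cardSg sAN; have := axial_norm axA Gg; rewrite kE -mul2n.
rewrite leq_mul2r (gtn_eqF (cardG_gt0 _)) /=.
case: k kE => [|[|[|]]] // kE _; last by right.
- by have := cardG_gt0 'N_G(A g); rewrite kE.
- by left; rewrite mul1n.
Qed.


(** The arithmetic of one class: n is the number of axes in it, and the class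
    occupies a proportion of at least 1/4 of G, or 1/2 when no element of G
    reverses the axis. *)
Lemma axis_class_data g : g \in G^# -> exists n,
  [/\ #|axis_class g| = (n * #|A g|.-1)%N, 0 < n, #|G| <= 4 * #|axis_class g| &
     [/\ (n * #|A g| = #|G|)%N, #|'N_G(A g)| = #|A g|
       & #|G| <= 2 * #|axis_class g| ] \/
     (n * 2 * #|A g| = #|G|)%N /\ #|'N_G(A g)| = (#|A g|).*2].
Proof.
move=> Gg; have := axial_gt1 Gg; have := Lagrange (subsetIl G 'N(A g)).
have := axial_norm_cases Gg; have := card_axis_class Gg.
have := indexg_gt0 G 'N_G(A g).
set n := #|G : _|; set b := #|A g|; set N := #|G|; set M := #|'N_G(A g)|.
move=> n_gt0 cE ME NE b_gt1; exists n.
have lecE k : M <= k * b.-1 -> N <= k * (n * b.-1).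
  by move=> le_M; rewrite -NE (mulnC M) mulnCA leq_mul2l le_M orbT.
rewrite cE; split=> //; first by apply: lecE; lia.
case: ME => ME; rewrite ME in NE lecE *; [left | right].
  by split=> //; [rewrite mulnC | apply: lecE; lia].
by split=> //; lia.
Qed.

(** The proportions given by [axis_class_data] leave at most three classes.  The
    hypothesis removes the cyclic and dihedral groups.  With one class, or with
    two classes having the same normaliser index, the class equation has no
    solution; with three classes every normaliser index is 2, for a class of
    proportion 1/2 together with two of proportion 1/4 would exhaust G, leaving
    no room for the identity. *)
Lemma axial_orders : G :!=: 1 -> {in G^#, forall g, (#|A g|).*2 < #|G|} ->
  [\/ #|G| = 12 /\ exists2 g, g \in G^# & #|A g| = 3,
      [/\ #|G| = 24, exists2 g, g \in G^# & #|A g| = 4 & {in G^#, forall g,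
         #|A g| \in [:: 2; 3; 4] /\ #|'N_G(A g)| = (#|A g|).*2}]
    | #|G| = 60 /\ {in G^#, forall g,
         #|A g| \in [:: 2; 3; 5] /\ #|'N_G(A g)| = (#|A g|).*2}].
Proof.
move=> ntG ltAG; have N_gt1 : 1 < #|G| by rewrite cardG_gt1.
pose T := axis_class @: G^#.
have sumT : (\sum_(X <- enum T) #|X| = #|G|.-1)%N.
  by rewrite big_enum /= -(card_partition axis_class_partition) (cardsD1 1 G) group1.
have classT X : X \in enum T -> exists2 g, g \in G^# & X = axis_class g.
  by rewrite mem_enum => /imsetP[g]; exists g.
have Tclass g : g \in G^# -> axis_class g \in enum T.
  by move=> Gg; rewrite mem_enum imset_f.
have cards g h : g \in G^# -> h \in G^# -> axis_class g = axis_class h ->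
    #|A g| = #|A h| /\ #|'N_G(A g)| = #|'N_G(A h)|.
  by move=> Gg Gh eq_gh; apply: axis_class_cards; rewrite // -eq_gh mem_axis_class.
have size_s : (size (enum T) * #|G| <= 4 * #|G|.-1)%N.
  rewrite -sumT big_distrr /= -sum1_size big_distrl /= !big_seq leq_sum // => X.
  by case/classT=> g Gg ->; have [n [_ _ + _]] := axis_class_data Gg; rewrite mul1n.
case: (enum T) sumT classT Tclass size_s => [|X1 [|X2 [|X3 [|X4 s]]]].
- by rewrite big_nil => sum0 _ _ _; lia.
- rewrite big_seq1 => sum /(_ X1 (mem_head _ _))[g Gg X1E] _ _.
  have lt := ltAG g Gg; have [n [cE n_gt0 _ dat]] := axis_class_data Gg.
  rewrite {}X1E {}cE in sum; have := muln_pred n (ltnW (axial_gt1 Gg)).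
  case: dat => [[NE _ _]|[NE _]] e; last by lia.
  have n1 : n = 1%N by lia.
  by rewrite n1 in NE; lia.
- rewrite big_cons big_seq1 => sum cl _ _.
  have [g1 Gg1 E1] := cl X1 (mem_head _ _).
  have [g2 Gg2 E2] := cl X2 (mem_last X1 [:: X2]).
  move: sum; rewrite E1 E2.
  have [n1 [c1 n1_gt0 _ dat1]] := axis_class_data Gg1.
  have [n2 [c2 n2_gt0 _ dat2]] := axis_class_data Gg2.
  have [lt1 lt2] := (ltAG g1 Gg1, ltAG g2 Gg2).
  have [gt1 gt2] := (axial_gt1 Gg1, axial_gt1 Gg2).
  have e1 := muln_pred n1 (ltnW gt1); have e2 := muln_pred n2 (ltnW gt2).
  move=> sum; constructor 1; rewrite c1 c2 in sum dat1 dat2.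
  case: dat1 dat2 => [[NE1 _ le1]|[NE1 _]] [[NE2 _ le2]|[NE2 _]].
  + lia.
  + have [-> b1 _] := class_equation2 NE1 NE2 gt1 gt2 lt1 lt2 sum.
    by split=> //; exists g1.
  + rewrite addnC in sum.
    have [-> b2 _] := class_equation2 NE2 NE1 gt2 gt1 lt2 lt1 sum.
    by split=> //; exists g2.
  + lia.
- rewrite !big_cons big_nil addn0 addnA => sum cl clG _.
  have [g1 Gg1 E1] := cl X1 (mem_head _ _).
  have [g2 Gg2 E2] := cl X2 (mem_nth X1 (isT : 1 < size [:: X1; X2; X3])).
  have [g3 Gg3 E3] := cl X3 (mem_last X1 [:: X2; X3]).
  move: sum clG; rewrite E1 E2 E3 => sum clG.
  have [n1 [c1 _ le1 dat1]] := axis_class_data Gg1.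
  have [n2 [c2 _ le2 dat2]] := axis_class_data Gg2.
  have [n3 [c3 _ le3 dat3]] := axis_class_data Gg3.
  case: dat1 => [[_ _ le1']|[NE1 e1]]; first by lia.
  case: dat2 => [[_ _ le2']|[NE2 e2]]; first by lia.
  case: dat3 => [[_ _ le3']|[NE3 e3]]; first by lia.
  rewrite c1 c2 c3 in sum.
  have [b [perm_b bN]] := class_equation3 NE1 NE2 NE3 (axial_gt1 Gg1)
    (axial_gt1 Gg2) (axial_gt1 Gg3) (ltAG g1 Gg1) (ltAG g2 Gg2) (ltAG g3 Gg3) sum.
  have exb k : k \in [:: 2; 3; b] -> exists2 g, g \in G^# & #|A g| = k.
    rewrite -(perm_mem perm_b) !inE => /or3P[] /eqP->;
      by [exists g1 | exists g2 | exists g3].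
  have allG : {in G^#, forall g, #|A g| \in [:: 2; 3; b] /\
                                 #|'N_G(A g)| = (#|A g|).*2}.
    move=> g Gg; have := clG g Gg; rewrite -(perm_mem perm_b) !inE.
    case/or3P=> /eqP clg; [have [-> ->] := cards _ _ Gg Gg1 clg
      | have [-> ->] := cards _ _ Gg Gg2 clg | have [-> ->] := cards _ _ Gg Gg3 clg];
      by rewrite eqxx ?orbT.
  move: bN; rewrite !inE => /or3P[] /eqP[bE NE]; rewrite {}NE; rewrite {}bE in exb allG.
  + by constructor 1; split=> //; apply: exb.
  + by constructor 2; split=> //; apply: exb.
  + by constructor 3.
- move=> _ _ _ le4; have : 4 * #|G| <= 4 * #|G|.-1.
    by apply: leq_trans le4; rewrite leq_mul2r orbT.
  lia.
Qed.

Lemma axis_class_sub g (B : {group gT}) : B <| G -> A g \subset B ->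
  axis_class g \subset B^#.
Proof.
case/andP=> _; rewrite -normD1 => /normsP nBG sAB.
rewrite /axis_class class_supportEr; apply/bigcupsP=> x Gx.
by rewrite -(nBG x Gx) conjSg setSD.
Qed.

(** The four Sylow 3-subgroups contain 8 elements of order 3, so the remaining 4
    elements form the Sylow 2-subgroup, which is therefore normal. *)
Lemma axial_order12 g : #|G| = 12 -> g \in G^# -> #|A g| = 3 ->
  exists B : {group gT}, [/\ B <| G, abelian B & #|G : B| = 3].
Proof.
move=> N12 Gg A3; have sylA : 3.-Sylow(G) (A g).
  by rewrite pHallE (axial_sub axA Gg) N12 A3 p_part.
have := card_Syl_mod G (isT : prime 3); rewrite (card_Syl sylA) => idx1.
have N3 : #|G : 'N_G(A g)| = 4.
  have := Lagrange (subsetIl G 'N(A g)); rewrite N12; move: idx1.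
  by have := axial_norm_cases Gg; rewrite A3 => -[] ->; case: #|G : _| => [|[|[|[|[|k]]]]] //; lia.
have [P sylP] := Sylow_exists 2 G; have [sPG] := and3P sylP.
have P4 : #|P| = 4 by rewrite (card_Hall sylP) N12 p_part.
pose S := G :\: axis_class g.
have sPS : P \subset S.
  rewrite subsetD sPG; apply/pred0P=> x /=; apply/negP=> /andP[Px].
  case/imset2P=> h y /setD1P[h1 Ah] Gy xE.
  have dvd4 : #[x] %| 4 by rewrite -P4 order_dvdG.
  have dvd3 : #[x] %| 3 by rewrite xE orderJ -A3 order_dvdG.
  have : #[x] %| 1%N by exact: (dvdn_sub dvd4 dvd3).
  by rewrite dvdn1 order_eq1 xE conjg_eq1 (negPf h1).
have classG : axis_class g \subset G.
  by rewrite class_support_subG // subDset setUC subsetU ?(axial_sub axA).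
have PS : P :=: S.
  apply/eqP; rewrite eqEcard sPS cardsD (setIidPr classG) card_axis_class //.
  by rewrite N12 N3 A3 P4.
exists P; split; last by rewrite -divgS // N12 P4.
  by rewrite /normal sPG PS normsD ?normG ?class_support_norm.
by rewrite (card_p2group_abelian (isT : prime 2)).
Qed.

(** The normaliser M of a stabiliser of order 4 is not normal: its 7 nontrivial
    elements cannot contain the 9 nontrivial elements of the three conjugate
    stabilisers.  So M meets some other conjugate in a subgroup of order 4, which
    has index 2 in both and hence is normalised by the whole group. *)
Lemma axial_order24 g : #|G| = 24 -> g \in G^# -> #|A g| = 4 ->
  #|'N_G(A g)| = 8 -> exists B : {group gT}, [/\ B <| G, abelian B & #|G : B| = 6].
Proof.
move=> N24 Gg A4 M8; set M := 'N_G(A g)%G in M8.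
have sMG : M \subset G := subsetIl _ _.
have [x Gx nMx] : exists2 x, x \in G & x \notin 'N(M).
  apply/subsetPn/negP => nMG.
  have M7 : #|M^#| = 7 by apply: succn_inj; rewrite -M8 (cardsD1 1 M) group1.
  have idx : #|G : M| = 3 by rewrite -divgS // N24 M8.
  have nsMG : M <| G by rewrite /normal sMG.
  have sAM : A g \subset M by rewrite subsetI (axial_sub axA Gg) normG.
  have := subset_leq_card (axis_class_sub nsMG sAM).
  by rewrite card_axis_class // idx A4 M7.
pose M' := (M :^ x)%G; pose B := (M :&: M')%G.
have M'8 : #|M'| = 8 by rewrite cardJg.
have sM'G : M' \subset G by rewrite -(conjGid Gx) conjSg.
have B4 : #|B| = 4.
  (* B is proper in M, and M * M' has at most 24 elements, so the product
     formula 64 = #|M * M'| * #|B| forces #|B| = 4. *)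
  have neqM : B != M.
    apply: contra nMx => /eqP BM; apply/normP/eqP; rewrite eq_sym eqEcard cardJg leqnn andbT.
    by rewrite -{1}BM subsetIr.
  have dvB : #|B| %| 8 by rewrite -M8 cardSg ?subsetIl.
  have : (#|M| * #|M'| = #|(M * M')%g| * #|B|)%N by rewrite mul_cardG.
  have : #|(M * M')%g| <= 24 by rewrite -N24 subset_leq_card // mul_subG.
  have : #|B| != 8.
    by apply: contra neqM => /eqP B8; rewrite -val_eqE eqEcard subsetIl M8 B8.
  rewrite M8 M'8; have := @dvdn_leq _ 8 isT dvB; move: dvB.
  by clear; move: #|(M * M')%g| #|B| => m [|[|[|[|[|[|[|[|[|b]]]]]]]]]; lia.
have nBM (K : {group gT}) : B \subset K -> #|K| = 8 -> K \subset 'N(B).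
  by move=> sBK K8; apply/normal_norm/index2_normal; rewrite // -divgS // K8 B4.
exists B; split; last by rewrite -divgS ?N24 ?B4 // subIset ?sMG.
  rewrite /normal subIset ?sMG //=.
  have sMN : M \subset 'N_G(B) by rewrite subsetI sMG nBM ?subsetIl.
  have sM'N : M' \subset 'N_G(B) by rewrite subsetI sM'G nBM ?subsetIr.
  suff /eqP NG : 'N_G(B) == G :> {set gT}.
    by rewrite -{1}NG subsetIr.
  have dvMN := cardSg sMN; have dvNG := cardSg (subsetIl G 'N(B)).
  rewrite eqEcard subsetIl N24.
  have : #|'N_G(B)| != 8.
    apply: contra nMx => /eqP N8.
    have MN : M :=: 'N_G(B) by apply/eqP; rewrite eqEcard sMN M8 N8.
    by apply/normP/eqP; rewrite eqEcard {2}MN sM'N cardJg leqnn.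
  move: dvMN dvNG; rewrite M8 N24 => /dvdnP[k ->].
  by case: k => [|[|[|k]]].
by rewrite (card_p2group_abelian (isT : prime 2)).
Qed.

Lemma axial_prime_sub g (C : {group gT}) :
  g \in G^# -> g \in C -> prime #|A g| -> A g \subset C.
Proof.
move=> Gg Cg prA; apply: prime_meetG => //; apply/trivgPn; exists g.
  by rewrite inE (axial_mem axA Gg).
by case/setD1P: Gg.
Qed.

(** A normal subgroup that meets a stabiliser of prime order nontrivially
    contains it, and with it all its conjugates. *)
Lemma card_axis_class_lt g (C : {group gT}) : g \in G^# -> C <| G ->
  g \in C -> prime #|A g| -> #|G : 'N_G(A g)| * #|A g|.-1 < #|C|.
Proof.
move=> Gg nsCG Cg prA; rewrite -card_axis_class // (cardsD1 1 C) group1 ltnS.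
by apply/subset_leq_card/axis_class_sub/axial_prime_sub.
Qed.

(** In order 24 the index 4 is impossible, because an abelian normal subgroup of
    order 6 would contain the 8 elements of order 3; index 5 does not divide 24.
    In order 60 a nontrivial abelian normal subgroup contains a whole class of
    stabilisers, hence at least 16 elements, while being abelian it lies in
    the normaliser of each of them, of order at most 10. *)
Theorem axial_min_abelian_index : exists B : {group gT},
  [/\ B <| G, abelian B, #|G : B| \in [:: 1; 2; 3; 6; 60]%N
    & forall C : {group gT}, C <| G -> abelian C -> #|G : B| <= #|G : C|].
Proof.
pose P (C : {group gT}) := (C <| G) && abelian C.
have P1 : P 1%G by rewrite /P normal1 abelian1.
exists [arg min_(C < 1%G | P C) #|G : C|].
case: arg_minnP => // B /andP[nsBG cBB] minB.
have {}minB (C : {group gT}) : C <| G -> abelian C -> #|G : B| <= #|G : C|.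
  by move=> nsCG cCC; apply: minB; rewrite /P nsCG.
split=> //; have sBG := normal_sub nsBG; have := indexg_gt0 G B.
have [G1 | ntG] := eqVneq (gval G) 1.
  have := minB G (normal_refl _); rewrite G1 indexgg => /(_ (abelian1 _)).
  by case: #|_ : B| => [|[|]].
case: (pickP [pred g in G^# | #|G| <= (#|A g|).*2]) => [g /andP[/= Gg leAG] | ltAG].
  have sAG := axial_sub axA Gg; have lei : #|G : A g| <= 2.
    by rewrite -(leq_pmul2l (cardG_gt0 (A g))) Lagrange // muln2.
  have nsAG : A g <| G.
    move: lei (indexg_gt0 G (A g)); case iE : #|G : A g| => [|[|[|]]] // _ _.
      by rewrite (index1g sAG iE) normal_refl.
    exact: index2_normal.
  have := leq_trans (minB _ nsAG (axial_abelian axA Gg)) lei.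
  by case: #|_ : B| => [|[|[|]]].
have {}ltAG : {in G^#, forall g, (#|A g|).*2 < #|G|}.
  by move=> g Gg; have := ltAG g; rewrite /= Gg ltnNge /= => ->.
case: (axial_orders ntG ltAG) => [[N12 [g Gg A3]]|[N24 [g Gg A4] allG]|[N60 allG]].
- have [C [nsCG cCC iC]] := axial_order12 N12 Gg A3.
  have := minB C nsCG cCC; rewrite iC.
  by case: #|_ : B| => [|[|[|[|]]]].
- have M8 : #|'N_G(A g)| = 8 by have [_ ->] := allG g Gg; rewrite A4.
  have [C [nsCG cCC iC]] := axial_order24 N24 Gg A4 M8.
  have := minB C nsCG cCC; rewrite iC => le6 i_gt0.
  have := Lagrange sBG; rewrite N24 mulnC => BE.
  have i_neq4 : #|G : B| != 4.
    apply/eqP => i4; have B6 : #|B| = 6 by rewrite i4 in BE; lia.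
    have [|h Bh h3] := @Cauchy _ 3 B isT; first by rewrite B6.
    have Gh : h \in G^#.
      by rewrite !inE (subsetP sBG) // andbT -order_eq1 h3.
    have [_ Mh] := allG h Gh.
    have Ah3 : #|A h| = 3.
      have := order_dvdG (axial_mem axA Gh); have [+ _] := allG h Gh.
      by rewrite h3 !inE => /or3P[] /eqP->.
    have := card_axis_class_lt Gh nsBG Bh; rewrite -divgS ?subsetIl //.
    by rewrite N24 Mh Ah3 B6 => /(_ isT).
  by move: #|_ : B| i_gt0 le6 i_neq4 BE {minB ltAG} => [|[|[|[|[|[|[|]]]]]]] //; lia.
- have [-> | /trivgPn[h Bh h1]] := eqVneq (gval B) 1; first by rewrite indexg1 N60.
  have Gh : h \in G^# by rewrite !inE h1 (subsetP sBG).
  have [Ah Mh] := allG h Gh.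
  have prA : prime #|A h| by move: Ah; rewrite !inE => /or3P[] /eqP->.
  have := card_axis_class_lt Gh nsBG Bh prA.
  have : #|B| <= #|'N_G(A h)|.
    apply: subset_leq_card; rewrite subsetI sBG /= cents_norm //.
    exact: subset_trans cBB (centS (axial_prime_sub Gh Bh prA)).
  rewrite -(divgS (subsetIl G 'N(A h))) N60 Mh; move: Ah; rewrite !inE.
  by case/or3P=> /eqP-> leB ltB; have := leq_trans ltB leB.
Qed.

End AxialGroups.

End AxialFamilies.

(** * Linear isometries of a definite form in dimension at most three *)

Section Isometries.
Import Order.TTheory GRing.Theory Num.Theory.
Local Open Scope ring_scope.

(** The two conclusions are the first row of M P = P (M^T)^-1, for M the matrix
    with rows (a, b) and (c, d) and P the symmetric matrix with rows (p, q) and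
    (q, r), with a q cancelled in the second one: the hypotheses say that
    det M = 1 and give the first row of M P M^T = P. *)
Lemma rotation_entries (R : comNzRingType) (a b c d p q r : R) :
  a * d - b * c = 1 ->
  (a * p + b * q) * a + (a * q + b * r) * b = p ->
  (a * p + b * q) * c + (a * q + b * r) * d = q ->
  a * p + b * q = d * p - b * q /\ b * r = - (c * p).
Proof.
move=> detM e11 e12; split; apply/eqP; rewrite -subr_eq0; apply/eqP.
  transitivity ((a * p + b * q) * (1 - (a * d - b * c))
    + d * ((a * p + b * q) * a + (a * q + b * r) * b - p)
    - b * ((a * p + b * q) * c + (a * q + b * r) * d - q)); first by ring.
  by rewrite detM e11 e12 !subrr !mulr0 ?subr0 !addr0 ?oppr0.
transitivity ((a * q + b * r) * (1 - (a * d - b * c))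
    - c * ((a * p + b * q) * a + (a * q + b * r) * b - p)
    + a * ((a * p + b * q) * c + (a * q + b * r) * d - q)); first by ring.
by rewrite detM e11 e12 !subrr !mulr0 ?subr0 !addr0 ?oppr0.
Qed.

Section InvariantForm.
Variables (R : realFieldType).

Definition posdef n (Q : 'M[R]_n) :=
  Q^T = Q /\ forall v : 'rV_n, v != 0 -> 0 < (v *m Q *m v^T) 0 0.

Lemma sqnorm_ge0 n (v : 'rV[R]_n) : 0 <= (v *m v^T) 0 0.
Proof.
by rewrite mxE sumr_ge0 // => i _; rewrite mxE -expr2 sqr_ge0.
Qed.

Lemma sqnorm_gt0 n (v : 'rV[R]_n) : v != 0 -> 0 < (v *m v^T) 0 0.
Proof.
case/rV0Pn=> i vi; rewrite mxE (bigD1 i) //= mxE -expr2.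
rewrite ltr_pwDl ?exprn_even_gt0 ?vi ?orbT //.
by rewrite sumr_ge0 // => j _; rewrite mxE -expr2 sqr_ge0.
Qed.

(** The Gram matrices rho h (rho h)^T summed over the group; left
    multiplication of the index permutes the terms, and the term of the
    identity already makes the sum definite. *)
Lemma invariant_form n (gT : finGroupType) (rho : gT -> 'M[R]_n) :
  {morph rho : g h / (g * h)%g >-> g *m h} -> rho 1%g = 1%:M ->
  exists2 Q, posdef Q & forall g, rho g *m Q *m (rho g)^T = Q.
Proof.
move=> rhoM rho1; exists (\sum_h rho h *m (rho h)^T); first split.
- by rewrite raddf_sum; apply: eq_bigr => h _; rewrite /= trmx_mul trmxK.
- move=> v v_neq0; rewrite mulmx_sumr mulmx_suml summxE (bigD1 1%g) //= rho1.
  rewrite trmx1 !mulmx1 ltr_pwDl ?sqnorm_gt0 // sumr_ge0 // => h _.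
  by rewrite mulmxA -mulmxA -trmx_mul sqnorm_ge0.
move=> g; rewrite mulmx_sumr mulmx_suml [RHS](reindex_inj (mulgI g)) /=.
by apply: eq_bigr => h _; rewrite rhoM trmx_mul !mulmxA.
Qed.

Lemma posdef_congr m n (Q : 'M[R]_n) (U : 'M_(m, n)) :
  posdef Q -> row_free U -> posdef (U *m Q *m U^T).
Proof.
move=> [symQ posQ] freeU; split=> [|v v_neq0].
  by rewrite !trmx_mul trmxK symQ mulmxA.
have := posQ (v *m U); rewrite trmx_mul !mulmxA; apply.
by rewrite mulmx_free_eq0.
Qed.

Lemma posdef_det n (Q : 'M[R]_n) : posdef Q -> \det Q != 0.
Proof.
move=> [_ posQ]; apply/negP => /det0P[v v_neq0 vQ].
by have := posQ v v_neq0; rewrite vQ mul0mx mxE ltxx.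
Qed.

Lemma posdef_corner n (Q : 'M[R]_n.+1) : posdef Q -> 0 < Q 0 0.
Proof.
move=> [_ posQ]; have := posQ (delta_mx 0 0).
rewrite -rowE trmx_delta -colE !mxE; apply.
by apply/rV0Pn; exists 0; rewrite mxE !eqxx oner_eq0.
Qed.

Definition isometry n (Q h : 'M[R]_n) := h *m Q *m h^T = Q /\ \det h = 1.

Lemma ord2_cases (i : 'I_2) : i = 0 \/ i = 1.
Proof. by case: i => [[|[|]] //] lt_i; [left | right]; apply/val_inj. Qed.

Lemma sum_ord2 (F : 'I_2 -> R) : \sum_i F i = F 0 + F 1.
Proof.
rewrite !big_ord_recl big_ord0 addr0.
by congr (_ + F _); apply/val_inj.
Qed.

Lemma det2 (M : 'M[R]_2) : \det M = M 0 0 * M 1 1 - M 0 1 * M 1 0.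
Proof.
have l00 : lift (0 : 'I_2) (0 : 'I_1) = 1 by apply/val_inj.
have l10 : lift (1 : 'I_2) (0 : 'I_1) = 0 by apply/val_inj.
rewrite (expand_det_row _ 0) sum_ord2 /cofactor !det_mx11 !mxE l00 l10 /=.
by rewrite addn0 expr0 expr1 mul1r mulN1r mulrN.
Qed.

(** The infinitesimal rotation for the form P, a generator of the Lie algebra of
    its special orthogonal group, acting on row vectors; for P = 1 it is the
    rotation by a right angle. *)
Definition turn (P : 'M[R]_2) : 'M[R]_2 :=
  \matrix_(i, j) if i == 0 then (if j == 0 then - P 0 1 else P 0 0)
                 else (if j == 0 then - P 1 1 else P 0 1).

(** Plane rotations are the combinations x + y J of the identity and
    one matrix J that depends on the form only, which makes it evident that they commute. *)
Lemma plane_isometry (P M : 'M[R]_2) : posdef P -> isometry P M ->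
  exists x y, M = x%:M + y *: turn P.
Proof.
move=> defP [MP detM]; have [symP _] := defP.
have q10 : P 1 0 = P 0 1 by rewrite -{1}symP mxE.
have p_gt0 := posdef_corner defP.
have e11 := congr1 (fun X : 'M_2 => X 0 0) MP.
have e12 := congr1 (fun X : 'M_2 => X 0 1) MP.
rewrite !mxE !sum_ord2 !mxE !sum_ord2 q10 in e11 e12; rewrite det2 in detM.
set p := P 0 0 in p_gt0 e11 e12; set q := P 0 1 in q10 e11 e12.
set r := P 1 1 in e11 e12.
set a := M 0 0 in e11 e12 detM; set b := M 0 1 in e11 e12 detM.
set c := M 1 0 in e11 e12 detM; set d := M 1 1 in e11 e12 detM.
have p_neq0 : p != 0 by rewrite gt_eqF.
have [e1 e2] := rotation_entries detM e11 e12.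
have [y bE] : exists y, b = y * p by exists (b / p); rewrite divfK.
have {}e1 : a - d + 2 * (y * q) = 0.
  apply: (mulIf p_neq0); rewrite bE in e1; lra.
have {}e2 : c = - (y * r).
  by apply: (mulIf p_neq0); rewrite bE in e2; lra.
exists ((a + d) / 2), y; apply/matrixP=> i j.
rewrite !mxE; have [->|->] := ord2_cases i; have [->|->] := ord2_cases j => /=;
  rewrite -/p -/q -/r -/a -/b -/c -/d ?mulr1n ?mulr0n; lra.
Qed.

Lemma posdef_det2_gt0 (P : 'M[R]_2) : posdef P -> 0 < P 0 0 * P 1 1 - P 0 1 ^+ 2.
Proof.
move=> defP; have [symP posP] := defP; have q10 : P 1 0 = P 0 1 by rewrite -{1}symP mxE.
have p_gt0 := posdef_corner defP.
pose u : 'rV_2 := \row_j if j == 0 then - P 0 1 else P 0 0.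
have /posP : u != 0 by apply/rV0Pn; exists 1; rewrite mxE gt_eqF.
rewrite !mxE !sum_ord2 !mxE !sum_ord2 !mxE /= q10.
by rewrite -[X in _ -> is_true X](pmulr_rgt0 _ p_gt0); congr (0 < _); ring.
Qed.

(** In the coordinates of [plane_isometry] the determinant of M - 1 is
    (x - 1)^2 + y^2 det P, a sum of squares with positive weights. *)
Lemma plane_isometry_fixed (P M : 'M[R]_2) : posdef P -> isometry P M ->
  \det (M - 1%:M) = 0 -> M = 1%:M.
Proof.
move=> posP isoM; have [x [y ->]] := plane_isometry posP isoM.
have := posdef_det2_gt0 posP.
rewrite det2 !mxE /= ?mulr1n ?mulr0n; set D := _ - _ => D_gt0 det0.
have {}det0 : (x - 1) ^+ 2 + y ^+ 2 * D = 0 by rewrite -det0 /D; ring.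
have y2D_ge0 : 0 <= y ^+ 2 * D by rewrite mulr_ge0 ?sqr_ge0 // ltW.
have x2_ge0 := sqr_ge0 (x - 1).
have : (x - 1) ^+ 2 = 0 by lra.
have : y ^+ 2 * D = 0 by lra.
move=> /eqP; rewrite mulf_eq0 (gt_eqF D_gt0) orbF sqrf_eq0 => /eqP->.
by move=> /eqP; rewrite sqrf_eq0 subr_eq0 => /eqP->; rewrite scale0r addr0.
Qed.

Lemma plane_isometry_comm (P M N : 'M[R]_2) : posdef P -> isometry P M ->
  isometry P N -> M *m N = N *m M.
Proof.
move=> posP isoM isoN; have [x [y ->]] := plane_isometry posP isoM.
have [z [t ->]] := plane_isometry posP isoN.
rewrite !mulmxDl !mulmxDr !mul_scalar_mx !mul_mx_scalar -!scalemxAl -!scalemxAr.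
rewrite !scale_scalar_mx [z * x]mulrC !scalerA [t * y]mulrC -!addrA; congr (_ + _).
by rewrite !addrA; congr (_ + _); rewrite addrC.
Qed.

Section Space.
Variable Q : 'M[R]_3.
Hypothesis posQ : posdef Q.

(** The rows of U span the orthogonal complement of v.  An isometry fixing v
    preserves this plane and acts on it as a plane isometry M of the
    restricted form. *)
Lemma axis_frame (v : 'rV[R]_3) : v != 0 ->
  exists U : 'M[R]_(2, 3),
    [/\ col_mx v U \in unitmx, row_free U
      & forall h, isometry Q h -> v *m h = v ->
        exists2 M : 'M[R]_2, isometry (U *m Q *m U^T) M & U *m h = M *m U].
Proof.
move=> v_neq0; pose w := Q *m v^T.
have vw_neq0 : (v *m w) 0 0 != 0 by rewrite mulmxA gt_eqF // (proj2 posQ).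
have rk2 : \rank (kermx w) = 2%N.
  rewrite mxrank_ker; have -> // : \rank w = 1%N.
  apply/eqP; rewrite eqn_leq rank_leq_col lt0n mxrank_eq0.
  by apply: contraNneq vw_neq0 => ->; rewrite mulmx0 mxE.
have [U UE] : exists U : 'M[R]_(2, 3), (U :=: kermx w)%MS.
  by move: (row_base _) (eq_row_base (kermx w)); rewrite rk2 => U; exists U.
have Uw : U *m w = 0 by apply: sub_kermxP; rewrite UE.
have frame : col_mx v U \in unitmx.
  rewrite -row_full_unit -sub1mx -(addsmxE v U); pose a := (v *m w) 0 0.
  rewrite -[X in (X <= _)%MS](addrNK (a^-1 *: (w *m v))) addrC.
  rewrite addmx_sub ?scalemx_sub ?(submx_trans (submxMl _ _)) ?addsmxSl //.
  rewrite (submx_trans _ (addsmxSr _ _)) // UE; apply/sub_kermxP.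
  rewrite mulmxBl mul1mx -scalemxAl -mulmxA [v *m w]mx11_scalar mul_mx_scalar.
  by rewrite scalerA mulVf // scale1r subrr.
exists U; split=> [//||h [hQ det_h] vh].
  by rewrite /row_free UE rk2.
have hw : h *m w = w by rewrite /w -{1}vh trmx_mul !mulmxA hQ.
have sKU : (kermx w <= U)%MS by rewrite UE.
have : (U *m h <= U)%MS.
  by apply: submx_trans sKU; apply/sub_kermxP; rewrite -mulmxA hw.
case/submxP=> M UhE; exists M => //; split.
  rewrite !mulmxA -UhE -!mulmxA -trmx_mul -UhE trmx_mul !mulmxA.
  by rewrite -(mulmxA U) -(mulmxA U) hQ.
have : \det (col_mx v U *m h) = \det (col_mx v U) * 1 by rewrite det_mulmx det_h.
have -> : col_mx v U *m h = block_mx 1%:M 0 0 M *m col_mx v U.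
  by rewrite mul_col_mx mul_block_col vh UhE mul1mx !mul0mx addr0 add0r.
rewrite det_mulmx det_ublock det1 mul1r mulrC; apply: mulfI.
by rewrite -unitfE -unitmxE.
Qed.

Lemma stabiliser_comm (v : 'rV[R]_3) (h k : 'M[R]_3) : v != 0 ->
  isometry Q h -> isometry Q k -> v *m h = v -> v *m k = v ->
  h *m k = k *m h.
Proof.
move=> v_neq0 isoh isok vh vk; have [U [frame freeU UP]] := axis_frame v_neq0.
have posP := posdef_congr posQ freeU.
have [M isoM UM] := UP h isoh vh; have [N isoN UN] := UP k isok vk.
apply: (can_inj (mulKmx frame)); rewrite !mul_col_mx !mulmxA vh vk vh UM UN.
by rewrite -!mulmxA UM UN !mulmxA (plane_isometry_comm posP isoM isoN).
Qed.

Lemma fixed_line (v w : 'rV[R]_3) (h : 'M[R]_3) : v != 0 -> isometry Q h ->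
  v *m h = v -> w *m h = w -> h != 1%:M -> exists c, w = c *: v.
Proof.
move=> v_neq0 isoh vh wh h_neq1; have [U [frame freeU UP]] := axis_frame v_neq0.
have posP := posdef_congr posQ freeU.
have [M isoM UM] := UP h isoh vh.
have := mulmxKV frame w; set z := w *m _; rewrite -[z]hsubmxK.
set c : 'M_1 := lsubmx z; set y := rsubmx z => wE.
have yM : y *m (M - 1%:M) = 0.
  have yU : y *m U = w - c *m v by rewrite -wE mul_row_col addrC addKr.
  apply/eqP; rewrite -(mulmx_free_eq0 _ freeU) -mulmxA mulmxBl mul1mx -UM.
  by rewrite mulmxBr mulmxA yU mulmxBl -mulmxA vh wh subrr.
have [y0 | y_neq0] := eqVneq y 0.
  exists (c 0 0); rewrite -wE mul_row_col y0 mul0mx addr0.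
  by rewrite [c in LHS]mx11_scalar mul_scalar_mx.
case/eqP: h_neq1; apply: (can_inj (mulKmx frame)).
have M1 : M = 1%:M.
  by apply: (plane_isometry_fixed posP isoM); apply/eqP/det0P; exists y.
by rewrite mulmx1 mul_col_mx vh UM M1 mul1mx.
Qed.

(** Invariance of Q gives (h - 1) Q h^T = - Q (h - 1)^T; in odd dimension,
    taking determinants yields det (h - 1) = - det (h - 1). *)
Lemma axis_exists (h : 'M[R]_3) : isometry Q h ->
  exists2 v : 'rV[R]_3, v != 0 & v *m h = v.
Proof.
move=> [hQ det_h].
have : \det ((h - 1%:M) *m Q *m h^T) = \det (- (Q *m (h - 1%:M)^T)).
  congr (\det _); rewrite !mulmxBl mul1mx hQ linearB /= trmx1 mulmxBr mulmx1.
  by rewrite opprB.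
rewrite -[- (Q *m _)]scaleN1r detZ !det_mulmx !det_tr det_h mulr1 mulrC -signr_odd expr1 mulN1r.
move=> eq_det; have : \det (h - 1%:M) = 0.
  apply: (mulfI (posdef_det posQ)); lra.
case/eqP/det0P=> v v_neq0; rewrite mulmxBr mulmx1 => /subr0_eq vh.
by exists v.
Qed.

Lemma axis_scale (v : 'rV[R]_3) (h : 'M[R]_3) (c : R) : v != 0 -> isometry Q h ->
  v *m h = c *: v -> c = 1 \/ c = -1.
Proof.
move=> v_neq0 [hQ _] vh; have := proj2 posQ v v_neq0.
have : c ^+ 2 * (v *m Q *m v^T) 0 0 = (v *m Q *m v^T) 0 0.
  rewrite -{2}hQ !mulmxA vh -2!mulmxA -trmx_mul vh mulmxA.
  by rewrite linearZ /= -!scalemxAl -scalemxAr scalerA !mxE.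
set n := (_ 0 0) => cn n_gt0; apply/pred2P; rewrite -eqf_sqr expr1n.
by apply/eqP/(mulIf (lt0r_neq0 n_gt0)); rewrite mul1r.
Qed.

End Space.
End InvariantForm.

(** * Axes of a finite rotation group *)

Section Rotations.
Variables (R : realFieldType) (gT : finGroupType) (rho : gT -> 'M[R]_3).
Hypothesis rhoM : {morph rho : g h / (g * h)%g >-> g *m h}.
Hypothesis rho_inj : injective rho.
Hypothesis rho_det : forall g, \det (rho g) = 1.

Lemma rep1 : rho 1%g = 1%:M.
Proof.
have rho1_unit : rho 1%g \in unitmx by rewrite unitmxE rho_det unitr1.
by apply: (can_inj (mulKmx rho1_unit)); rewrite -rhoM mulg1 mulmx1.
Qed.

Lemma rep_neq1 g : g != 1%g -> rho g != 1%:M.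
Proof. by apply: contra_neq => rg1; apply: rho_inj; rewrite rg1 rep1. Qed.

Definition stab_set (v : 'rV[R]_3) : {set gT} := [set h | v *m rho h == v].

Lemma stab_group_set v : group_set (stab_set v).
Proof.
apply/group_setP; split=> [|h k]; rewrite !inE ?rep1 ?mulmx1 //.
by move=> /eqP vh /eqP vk; rewrite rhoM mulmxA vh vk.
Qed.
Canonical stab v := Group (stab_group_set v).

Lemma stabZ c v : c != 0 -> stab (c *: v) = stab v.
Proof.
move=> c_neq0; apply/val_inj/setP=> h; rewrite !inE -scalemxAl.
by rewrite (inj_eq (scalerI c_neq0)).
Qed.

Lemma rep_fixedJ (v : 'rV[R]_3) g x : v *m rho g = v ->
  v *m rho x *m rho (g ^ x)%g = v *m rho x.
Proof. by move=> vg; rewrite -mulmxA -rhoM -conjgC rhoM mulmxA vg. Qed.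

(** Vectors are rows, so the group acts on the right and the stabiliser of the
    image of v under x is the conjugate by x. *)
Lemma stabJ v x : stab (v *m rho x) = (stab v :^ x)%G.
Proof.
apply/val_inj/setP=> h; rewrite /= mem_conjg !inE; apply/eqP/eqP => [vxh|].
  have := rep_fixedJ x^-1%g vxh.
  by rewrite -(mulmxA v (rho x)) -rhoM mulgV rep1 mulmx1.
by move=> /(rep_fixedJ x); rewrite conjgKV.
Qed.

(** For g = 1 every vector is fixed, and this is an arbitrary nonzero one. *)
Definition axis g := nz_row (kermx (rho g - 1%:M)).

Lemma axis_fixed g : axis g *m rho g = axis g.
Proof.
apply/eqP; rewrite -subr_eq0 -{2}[axis g]mulmx1 -mulmxBr; apply/eqP.
by apply: sub_kermxP; apply: nz_row_sub.
Qed.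

Theorem rotation_axial : axial [set: gT]%G (stab \o axis).
Proof.
have [Q posQ invQ] := invariant_form rhoM rep1.
have isoQ g : isometry Q (rho g) by split.
have axis_neq0 g : axis g != 0.
  rewrite nz_row_eq0; have [v v_neq0 vg] := axis_exists posQ (isoQ g).
  apply: contraNneq v_neq0 => ker0; rewrite -submx0 -ker0; apply/sub_kermxP.
  by rewrite mulmxBr mulmx1 vg subrr.
have axis_unique g v : g != 1%g -> v != 0 -> v *m rho g = v ->
    stab (axis g) = stab v.
  move=> g_neq1 v_neq0 vg.
  have [c aE] := fixed_line posQ v_neq0 (isoQ g) vg (axis_fixed g) (rep_neq1 g_neq1).
  rewrite aE stabZ //; apply: contraNneq (axis_neq0 g) => c0.
  by rewrite aE c0 scale0r.
have neq0J v x : v != 0 -> v *m rho x != 0.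
  move=> v_neq0; apply: contraNneq v_neq0 => vx0.
  by rewrite -[v]mulmx1 -rep1 -(mulgV x) rhoM mulmxA vx0 mul0mx.
split; first by move=> g _; apply: subsetT.
- by move=> g _; rewrite inE axis_fixed.
- move=> g _; apply/centsP=> h; rewrite inE => /eqP gh k; rewrite inE => /eqP gk.
  by apply: rho_inj; rewrite !rhoM; apply: (stabiliser_comm posQ (axis_neq0 g)).
- by move=> g _ h /setD1P[h_neq1 +]; rewrite inE => /eqP gh; apply: axis_unique (axis_neq0 g) gh.
- move=> g x /setD1P[g_neq1 _] _; rewrite /= -stabJ; apply: axis_unique; first by rewrite conjg_eq1.
    exact: neq0J.
  exact/rep_fixedJ/axis_fixed.
move=> g /setD1P[g_neq1 _] /=; set v := axis g; set S := stab v.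
(* The elements normalising S fix or reverse v, and those reversing it, if
   any, form a single right coset of S. *)
have normS x : (x \in 'N_([set: gT])(S))%g -> v *m rho x = v \/ v *m rho x = - v.
  case/setIP=> _ nSx; have Sgx : (g ^ x)%g \in S.
    by rewrite memJ_norm // inE axis_fixed.
  rewrite inE in Sgx; have gx_neq1 : (g ^ x)%g != 1%g by rewrite conjg_eq1.
  have [c vx] := fixed_line posQ (axis_neq0 g) (isoQ _) (eqP Sgx)
    (rep_fixedJ x (axis_fixed g)) (rep_neq1 gx_neq1).
  have [cE|cE] := axis_scale posQ (axis_neq0 g) (isoQ x) vx.
    by left; rewrite -/v vx cE scale1r.
  by right; rewrite vx cE scaleN1r.
have [t /eqP vt|noflip] := pickP [pred t | v *m rho t == - v].
  rewrite -addnn -{2}(card_rcoset S t) (leq_trans _ (leq_card_setU _ _)) //.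
  apply/subset_leq_card/subsetP=> x /normS[] vx.
    by rewrite !inE vx eqxx.
  rewrite inE orbC mem_rcoset inE rhoM mulmxA vx -vt -mulmxA -rhoM mulgV rep1.
  by rewrite mulmx1 eqxx.
rewrite -addnn (leq_trans _ (leq_addr _ _)) // subset_leq_card //.
apply/subsetP=> x /normS[] vx; first by rewrite inE vx.
by have := noflip x; rewrite /= vx eqxx.
Qed.

End Rotations.

End Isometries.

(** * From the projective group to rotations *)

Section Lifting.
Import Order.TTheory GRing.Theory Num.Theory.
Local Open Scope ring_scope.
Local Open Scope quotient_scope.

Lemma cube_root (R : rcfType) (a : R) : exists d, d ^+ 3 = a.
Proof.
pose m := 1 + `|a|; have a_le : - `|a| <= a <= `|a| by rewrite -ler_norml.
have m_ge1 : 1 <= m by rewrite lerDl.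
have m3 : m <= m ^+ 3 by rewrite -{1}[m]expr1 ler_weXn2l.
have [||d _] := @poly_ivt R ('X^3 - a%:P) (- m) m.
- by rewrite lerNl; lra.
- by rewrite !hornerE /= exprNn; apply/andP; split; rewrite /m in m3 *; lra.
by rewrite /root !hornerE subr_eq0 => /eqP; exists d.
Qed.

Lemma cube_eq1 (R : realFieldType) (d : R) : d ^+ 3 = 1 -> d = 1.
Proof.
move=> d3; have : (d - 1) * ((d + 1) ^+ 2 + d ^+ 2 + 1) = 0.
  have -> : (d - 1) * ((d + 1) ^+ 2 + d ^+ 2 + 1) = 2 * (d ^+ 3 - 1) by ring.
  by rewrite d3 subrr mulr0.
move/eqP; rewrite mulf_eq0 subr_eq0 => /orP[/eqP // | ].
by rewrite gt_eqF // ltr_wpDl // addr_ge0 ?sqr_ge0.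
Qed.

(** The scalar relating U and V is real, being a quotient of entries, and its
    cube is 1 by comparing determinants. *)
Lemma PGL_map_inj_SL3 (R : realType) (U V : GL R 3) :
  \det U = 1 -> \det V = 1 ->
  PGL_map (real_complex R) (\pi U) = PGL_map (real_complex R) (\pi V) -> U = V.
Proof.
rewrite !PGL_map_pi => detU detV /PGL_piP[c /= UV].
have [i [j Vij]] : exists i j, V i j != 0.
  apply: contrapT => V0; have : \det V == 0.
    rewrite (_ : GL_mx V = 0) ?det0 //; apply/matrixP=> i j; rewrite mxE.
    by apply: contrapT => /eqP Vij; apply: V0; exists i, j.
  by rewrite detV oner_eq0.
have cE : c = real_complex R (U i j / V i j).
  have Uij : real_complex R (U i j) = c * real_complex R (V i j).
    by have := congr1 (fun X : 'M_3 => X i j) UV; rewrite !mxE.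
  by rewrite fmorph_div /= Uij mulfK // fmorph_eq0.
have {}UV : GL_mx U = (U i j / V i j) *: GL_mx V.
  by apply: (map_mx_inj (f := real_complex R)); rewrite UV cE map_mxZ.
move: (U i j / V i j) UV => d UV; have d1 : d = 1.
  by apply: cube_eq1; rewrite -detU UV detZ detV mulr1.
by apply/val_inj; rewrite /= UV d1 scale1r.
Qed.

Lemma definable_rotations (R : realType) (G : finSubgroup (PGL R[i] 3)) :
  definable_over_reals G -> exists rho : fsg_type G -> 'M[R]_3,
    [/\ {morph rho : x y / (x * y)%g >-> x *m y}, injective rho
      & forall x, \det (rho x) = 1].
Proof.
case=> H [g [_ GH]].
have lift (x : fsg_type G) : exists U : GL R 3,
    \det U = 1 /\ (val x ^ g)%g = PGL_map (real_complex R) (\pi U).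
  have /GH[h _ xE] : val x \in fsg_fset G := valP x.
  elim/generic_quotient.quotW: h xE => W xE.
  have [d d3] := cube_root (\det W).
  have d_neq0 : d != 0.
    apply/eqP => d0; have := Defs.GL_unit W.
    by rewrite unitmxE -d3 d0 expr0n unitr0.
  have U_unit : d^-1 *: GL_mx W \in unitmx.
    by rewrite unitmxZ ?unitfE ?invr_eq0 ?Defs.GL_unit.
  exists (MkGL U_unit); split.
    by rewrite /= detZ -d3 -exprMn mulVf // expr1n.
  rewrite xE; congr (PGL_map _ _); apply/PGL_piP; exists d.
  by rewrite /= scalerA divff // scale1r.
have [rho rhoP] := choice lift; exists (fun x => GL_mx (rho x)); split.
- move=> x y; have [detx xE] := rhoP x; have [dety yE] := rhoP y.
  have [detxy xyE] := rhoP (x * y)%g.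
  suff -> : rho (x * y)%g = (rho x * rho y)%g by [].
  apply: PGL_map_inj_SL3; rewrite ?detxy //.
    by rewrite /= det_mulmx detx dety mulr1.
  by rewrite -xyE (PGL_piM (rho x)) [RHS]PGL_mapM -xE -yE -conjMg.
- move=> x y /val_inj eq_rho; have [_ xE] := rhoP x; have [_ yE] := rhoP y.
  by apply/val_inj/(conjg_inj g); rewrite xE yE eq_rho.
- by move=> x; have [] := rhoP x.
Qed.

End Lifting.

(** The Jordan constant is attained: unless it is 1, some subgroup H violates
    the bound obtained by lowering it by 1, and the least index of an abelian
    normal subgroup of H is then exactly the Jordan constant. *)
Lemma jordan_constant_mem (gT : groupType) (S : seq nat) : 1 \in S ->
  (forall H : finSubgroup gT, exists A : {group fsg_type H},
    [/\ (A <| [set: fsg_type H])%g, abelian A, #|[set: fsg_type H] : A|%g \in S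
      & forall C : {group fsg_type H}, (C <| [set: fsg_type H])%g -> abelian C ->
        #|[set: fsg_type H] : A|%g <= #|[set: fsg_type H] : C|%g]) ->
  jordan_constant gT \in S.
Proof.
move=> S1 minH; have leS s : s \in S -> s <= \max_(i <- S) i.
  by move=> Ss; apply: (leq_bigmax_seq (F := id)).
have maxS : jordan_bound gT (\max_(i <- S) i).
  by move=> H; have [A [nA cA SA _]] := minH H; exists A; split=> //; apply: leS.
have [J_gt0 bJ _] := jordan_constant_least (leS 1 S1) maxS.
have [Jle1 | J_gt1] := leqP (jordan_constant gT) 1.
  by rewrite (_ : jordan_constant gT = 1) //; apply/eqP; rewrite eqn_leq Jle1.
have /existsNP[H noH] : ~ jordan_bound gT (jordan_constant gT).-1.
  move=> bJ'; have [|_ _] := jordan_constant_least _ bJ'.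
    by rewrite -ltnS prednK.
  by rewrite leqNgt prednK // leqnn.
have [A [nA cA SA minA]] := minH H; have [C [nC cC leC]] := bJ H.
suff -> : jordan_constant gT = #|[set: fsg_type H] : A|%g by [].
apply/eqP; rewrite eqn_leq (leq_trans (minA C nC cC) leC) andbT.
rewrite leqNgt; apply/negP => ltA; apply: noH; exists A; split=> //.
by rewrite -ltnS prednK.
Qed.

Theorem mainTheorem8 (R : realType) (G : finSubgroup (PGL R[i] 3))
    (hG : definable_over_reals G) :
  jordan_constant (fsg_type G) \in [:: 1; 2; 3; 6; 60].
Proof.
have [rho [rhoM rho_inj rho_det]] := definable_rotations hG.
apply: jordan_constant_mem => // H; pose rhoH (x : fsg_type H) := rho (val x).
have rhoHM : {morph rhoH : x y / (x * y)%g >-> (x *m y)%R}.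
  by move=> x y; apply: rhoM.
have rhoH_inj : injective rhoH by move=> x y /rho_inj/val_inj.
exact: axial_min_abelian_index (rotation_axial rhoHM rhoH_inj (fun x => rho_det _)).
Qed.
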